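(* There is no least hereditarily structurally complete deductive system above $\mathsf{IPC}$: there is no hereditarily structurally complete deductive extension $S_0$ of $\mathsf{IPC}$ such that every hereditarily structurally complete deductive extension of $\mathsf{IPC}$ is a deductive extension of $S_0$.
   Context: Formulas are built from a countably infinite set of variables with the connectives $\wedge,\vee,\to,\neg$. A rule is a pair $\Gamma/A$ with $\Gamma$ a finite (possibly empty) set of formulas and $A$ a formula. A deductive system is a pair $S=\langle Ax,R\rangle$ of a nonempty set of formulas and a nonempty set of rules. For finite $\Gamma$, $\Gamma\vdash_S A$ means there is a sequence $B_1,\dots,B_n=A$ where each $B_i$ is in $\Gamma$, or is a substitution instance of a formula of $Ax$, or there is a substitution instance $\Delta/B_i$ of a rule in $R$ with $\Delta\subseteq\{B_1,\dots,B_{i-1}\}$. $L(S)=\{A:\ \vdash_S A\}$. $S'$ is a deductive extension of $S$ if $\vdash_S\subseteq\vdash_{S'}$. A rule $r$ is admissible in $S=\langle Ax,R\rangle$ if $L(\langle Ax,R\cup\{r\}\rangle)=L(S)$; $\Gamma/A$ is derivable in $S$ if $\Gamma\vdash_S A$. $S$ is structurally complete if every rule admissible in $S$ is derivable in $S$; it is hereditarily structurally complete if it is structurally complete and every deductive extension of it is structurally complete. $\mathsf{IPC}=\langle Ax^i,\{\mathsf{mp}\}\rangle$, where $Ax^i$ is a standard set of axiom schemes of intuitionistic propositional calculus and $\mathsf{mp}$ is Modus Ponens $A,A\to B/B$. *)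

(* Defs.v *)
From Stdlib Require Import List.
Import ListNotations.

Inductive formula : Type :=
| Var (n : nat)
| And (A B : formula)
| Or (A B : formula)
| Imp (A B : formula)
| Neg (A : formula).

Fixpoint subst (s : nat -> formula) (A : formula) : formula :=
  match A with
  | Var n => s n
  | And B C => And (subst s B) (subst s C)
  | Or B C => Or (subst s B) (subst s C)
  | Imp B C => Imp (subst s B) (subst s C)
  | Neg B => Neg (subst s B)
  end.

(* Finite sets of formulas are represented by lists.  Every notion below uses
   such a list only through [In] and [incl], so order and repetitions are
   irrelevant. *)
Record rule : Type := Rule {
  premises : list formula;
  conclusion : formula
}.

Record deductive_system : Type := DeductiveSystem {
  axioms : formula -> Prop;
  rules : rule -> Prop;
  axioms_nonempty : exists A, axioms A;
  rules_nonempty : exists r, rules r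
}.

(* [justified S Gamma prev B]: B may be written after the formulas [prev] in a
   derivation from Gamma. *)
Definition justified (S : deductive_system) (Gamma prev : list formula)
    (B : formula) : Prop :=
  In B Gamma
  \/ (exists (s : nat -> formula) (C : formula),
        axioms S C /\ B = subst s C)
  \/ (exists (s : nat -> formula) (r : rule),
        rules S r
        /\ B = subst s (conclusion r)
        /\ incl (map (subst s) (premises r)) prev).

Definition derivation (S : deductive_system) (Gamma Bs : list formula) : Prop :=
  forall (prev : list formula) (B : formula) (next : list formula),
    Bs = prev ++ B :: next -> justified S Gamma prev B.

Definition derives (S : deductive_system) (Gamma : list formula)
    (A : formula) : Prop :=
  exists Bs : list formula, derivation S Gamma (Bs ++ [A]).

Definition theorems (S : deductive_system) (A : formula) : Prop :=
  derives S [] A.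

Definition deductive_extension (S S' : deductive_system) : Prop :=
  forall (Gamma : list formula) (A : formula),
    derives S Gamma A -> derives S' Gamma A.

Definition add_rule (S : deductive_system) (r : rule) : deductive_system :=
  {| axioms := axioms S;
     rules := fun r' => rules S r' \/ r' = r;
     axioms_nonempty := axioms_nonempty S;
     rules_nonempty := ex_intro _ r (or_intror eq_refl) |}.

Definition admissible (S : deductive_system) (r : rule) : Prop :=
  forall A : formula, theorems (add_rule S r) A <-> theorems S A.

Definition derivable (S : deductive_system) (r : rule) : Prop :=
  derives S (premises r) (conclusion r).

Definition structurally_complete (S : deductive_system) : Prop :=
  forall r : rule, admissible S r -> derivable S r.

Definition hereditarily_structurally_complete (S : deductive_system) : Prop :=
  structurally_complete S
  /\ forall S' : deductive_system,
       deductive_extension S S' -> structurally_complete S'.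

(* Schemes are given by single formulas in the variables p, q, r, since
   derivations close under substitution instances. *)
Definition ipc_axioms : list formula :=
  let p := Var 0 in
  let q := Var 1 in
  let r := Var 2 in
  [ Imp p (Imp q p);
    Imp (Imp p (Imp q r)) (Imp (Imp p q) (Imp p r));
    Imp (And p q) p;
    Imp (And p q) q;
    Imp p (Imp q (And p q));
    Imp p (Or p q);
    Imp q (Or p q);
    Imp (Imp p r) (Imp (Imp q r) (Imp (Or p q) r));
    Imp (Imp p q) (Imp (Imp p (Neg q)) (Neg p));
    Imp (Neg p) (Imp p q) ].

Definition modus_ponens : rule :=
  Rule [Var 0; Imp (Var 0) (Var 1)] (Var 1).

Definition IPC : deductive_system :=
  {| axioms := fun A => In A ipc_axioms;
     rules := fun r => r = modus_ponens;
     axioms_nonempty := ex_intro _ _ (or_introl eq_refl);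
     rules_nonempty := ex_intro _ modus_ponens eq_refl |}.

(* Main.v *)
(** Write [A] for the algebra of upsets of the frame with points 0, ..., 5 in
    which 2 lies below 0, 3 below 0 and 1, 4 below 2 and 3, and 5 below 1 and 2
    (the six topmost points of the Rieger-Nishimura ladder), and [E] for its
    quotient given by the points 0, ..., 4.  The systems of all rules valid in
    [A], respectively in [E], are hereditarily structurally complete, so a least
    system would lie below both, and the system [S] of all rules valid in [A]
    and [E] would be structurally complete.  But [E] is a quotient of [A] that
    does not embed into [A]: a rule expressing this non-embedding is valid in
    [A] and fails in [E], so it is not derivable in [S]; adding it to [S] gives
    only theorems valid in [A], which are valid in [E] and hence theorems of
    [S], so it is admissible.

    Hereditary structural completeness of the system of a finite algebra [B]:
    let [S'] be an extension that does not derive [Gamma/C].  Since [B] is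
    finite, some valuation in [B] satisfies every consequence of [Gamma] in [S']
    and refutes [C]; let [D] be the subalgebra of its values.  If [D] maps onto
    an algebra that is given by terms as a retract of a free algebra, in such a
    way that the terms still separate the value of [C] from 1 when evaluated in
    [D], then substituting the terms turns [Gamma] into theorems of [S'] and
    [C] into a non-theorem, so [Gamma/C] is not admissible.  For [A] and [E],
    free on one generator in the varieties they generate, all subalgebras [D]
    can be checked by computation. *)

From Stdlib Require Import List Arith NArith Bool Lia Classical.
Require Import Defs.
Import ListNotations.

(** * Derivations *)

Lemma justified_incl S Gamma prev prev' B :
  incl prev prev' -> justified S Gamma prev B -> justified S Gamma prev' B.
Proof.
  intros Hi [H | [H | (s & r & Hr & HB & Hp)]]; [now left | now right; left |].
  right; right; exists s, r; split; [|split]; trivial.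
  now apply incl_tran with prev.
Qed.

Lemma derivation_nil S Gamma : derivation S Gamma [].
Proof. intros prev B next H; now destruct prev. Qed.

Lemma derivation_snoc S Gamma Bs A :
  derivation S Gamma (Bs ++ [A]) <->
  derivation S Gamma Bs /\ justified S Gamma Bs A.
Proof.
  split.
  - intros H; split.
    + intros prev B next E; apply (H prev B (next ++ [A])).
      now rewrite E, <- app_assoc.
    + now apply (H Bs A []).
  - intros [HBs HA] prev B next E.
    destruct next as [|C next _] using rev_ind.
    + apply app_inj_tail in E as [<- <-]; exact HA.
    + rewrite app_comm_cons, app_assoc in E.
      apply app_inj_tail in E as [E _]; exact (HBs _ _ _ E).
Qed.

Lemma derivation_app S Gamma Bs Cs :
  derivation S Gamma Bs -> derivation S Gamma Cs ->
  derivation S Gamma (Bs ++ Cs).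
Proof.
  intros HB; induction Cs as [|C Cs IH] using rev_ind; intros HC.
  - now rewrite app_nil_r.
  - apply derivation_snoc in HC as [HCs HC].
    rewrite app_assoc; apply derivation_snoc; split; [now apply IH|].
    apply justified_incl with Cs; [apply incl_appr, incl_refl | exact HC].
Qed.

Lemma derivation_collect S Gamma L :
  (forall A, In A L -> derives S Gamma A) ->
  exists Bs, derivation S Gamma Bs /\ incl L Bs.
Proof.
  induction L as [|A L IH]; intros H.
  - exists []; split; [apply derivation_nil | apply incl_nil_l].
  - destruct IH as (Bs & HBs & Hi); [intros; apply H; now right|].
    destruct (H A) as (Cs & HCs); [now left|].
    exists (Bs ++ (Cs ++ [A])); split; [now apply derivation_app|].
    apply incl_cons; [|now apply incl_appl].
    rewrite !in_app_iff; right; right; now left.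
Qed.

Lemma derives_justified S Gamma L A :
  (forall B, In B L -> derives S Gamma B) -> justified S Gamma L A ->
  derives S Gamma A.
Proof.
  intros H HA; destruct (derivation_collect _ _ _ H) as (Bs & HBs & Hi).
  exists Bs; apply derivation_snoc; split; [exact HBs|].
  now apply justified_incl with L.
Qed.

Lemma derives_hyp S Gamma A : In A Gamma -> derives S Gamma A.
Proof. intros H; apply derives_justified with []; [easy | now left]. Qed.

Lemma derives_axiom S Gamma s A : axioms S A -> derives S Gamma (subst s A).
Proof.
  intros H; apply derives_justified with []; [easy|].
  right; left; now exists s, A.
Qed.

Lemma derives_rule S Gamma s r :
  rules S r ->
  (forall A, In A (premises r) -> derives S Gamma (subst s A)) ->
  derives S Gamma (subst s (conclusion r)).
Proof.
  intros Hr H; apply derives_justified with (map (subst s) (premises r)).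
  - intros B HB; apply in_map_iff in HB as (A & <- & HA); auto.
  - right; right; exists s, r; repeat split; trivial; apply incl_refl.
Qed.

Lemma derives_ind S Gamma (P : formula -> Prop) :
  (forall A, In A Gamma -> P A) ->
  (forall s A, axioms S A -> P (subst s A)) ->
  (forall s r, rules S r -> (forall A, In A (premises r) -> P (subst s A)) ->
               P (subst s (conclusion r))) ->
  forall A, derives S Gamma A -> P A.
Proof.
  intros Hh Ha Hr.
  assert (H : forall Bs, derivation S Gamma Bs -> forall B, In B Bs -> P B).
  { induction Bs as [|A Bs IH] using rev_ind; intros HD B HB; [easy|].
    apply derivation_snoc in HD as [HBs HA].
    apply in_app_iff in HB as [HB | [<- | []]]; [now apply IH|].
    destruct HA as [HA | [(s & C & HC & ->) | (s & r & HR & -> & Hp)]]; auto.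
    apply Hr; trivial; intros C HC; apply IH; trivial.
    now apply Hp, in_map. }
  intros A [Bs HBs]; apply (H _ HBs), in_app_iff; right; now left.
Qed.

Lemma derives_cut S Gamma Delta A :
  (forall B, In B Delta -> derives S Gamma B) -> derives S Delta A ->
  derives S Gamma A.
Proof.
  intros H; apply derives_ind; trivial.
  - intros; now apply derives_axiom.
  - intros; now apply derives_rule.
Qed.

Lemma subst_subst s s' A :
  subst s (subst s' A) = subst (fun n => subst s (s' n)) A.
Proof. induction A; simpl; congruence. Qed.

Lemma derives_subst S Gamma A s :
  derives S Gamma A -> derives S (map (subst s) Gamma) (subst s A).
Proof.
  revert A; apply (derives_ind _ _ (fun A => derives S _ (subst s A))).
  - intros A HA; now apply derives_hyp, in_map.
  - intros s' A HA; rewrite subst_subst; now apply derives_axiom.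
  - intros s' r Hr H; rewrite subst_subst; apply derives_rule; trivial.
    intros A HA; rewrite <- subst_subst; auto.
Qed.

Lemma admissible_instance S r s :
  admissible S r ->
  (forall A, In A (premises r) -> theorems S (subst s A)) ->
  theorems S (subst s (conclusion r)).
Proof.
  intros Hr H; apply Hr; apply (derives_rule (add_rule S r)); [now right|].
  intros A HA; apply Hr; auto.
Qed.

Fixpoint below (n : nat) (A : formula) : bool :=
  match A with
  | Var i => Nat.ltb i n
  | And B C | Or B C | Imp B C => below n B && below n C
  | Neg B => below n B
  end.

Lemma below_le n m A : n <= m -> below n A = true -> below m A = true.
Proof.
  intros H; induction A; simpl; rewrite ?andb_true_iff, ?Nat.ltb_lt;
    [lia | tauto..].
Qed.

Lemma below_exists L : exists n, forall A, In A L -> below n A = true.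
Proof.
  assert (H1 : forall A, exists n, below n A = true).
  { induction A as [i|A [n Hn] B [m Hm]|A [n Hn] B [m Hm]|A [n Hn] B [m Hm]|];
      simpl; trivial.
    1: now exists (S i); apply Nat.ltb_lt, Nat.lt_succ_diag_r.
    all: exists (Nat.max n m); apply andb_true_iff; split;
      (eapply below_le; [|eassumption]; lia). }
  induction L as [|A L [n Hn]]; [now exists 0|].
  destruct (H1 A) as [m Hm]; exists (Nat.max n m).
  intros B [<- | HB]; (eapply below_le; [|eauto]; lia).
Qed.

Lemma subst_below n s A :
  (forall i, i < n -> s i = Var i) -> below n A = true -> subst s A = A.
Proof.
  intros Hs; induction A; simpl; rewrite ?andb_true_iff, ?Nat.ltb_lt;
    [auto | intros; f_equal; tauto..].
Qed.

(** * Heyting algebras of finite frames *)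

(* A frame on the points 0, ..., k-1 is the list of its principal upsets, and a
   set of points is the number with the corresponding binary digits. *)
Definition frame := list N.

Fixpoint imp (F : frame) (u v : N) : N :=
  match F with
  | [] => 0%N
  | a :: F' => (if N.eqb (N.ldiff (N.land a u) v) 0
                then N.succ_double else N.double) (imp F' u v)
  end.

Definition top (F : frame) : N := imp F 0 0.

(** Implication from the top is the interior operator, whose fixed points are the upsets. *)
Definition elements (F : frame) : list N :=
  filter (fun u => N.eqb (imp F (top F) u) u)
    (map N.of_nat (seq 0 (2 ^ length F))).

Fixpoint eval (F : frame) (v : nat -> N) (A : formula) : N :=
  match A with
  | Var i => v i
  | And B C => N.land (eval F v B) (eval F v C)
  | Or B C => N.lor (eval F v B) (eval F v C)
  | Imp B C => imp F (eval F v B) (eval F v C)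
  | Neg B => imp F (eval F v B) 0
  end.

Definition mem (u : N) (D : list N) : bool := existsb (N.eqb u) D.

Definition closed (F : frame) (D : list N) : bool :=
  forallb (fun a =>
    mem (imp F a 0) D &&
    forallb (fun b =>
      mem (N.land a b) D && mem (N.lor a b) D && mem (imp F a b) D) D) D.

Definition morphism (F G : frame) (h : N -> N) (D : list N) : bool :=
  forallb (fun a =>
    N.eqb (h (imp F a 0)) (imp G (h a) 0) &&
    forallb (fun b =>
      N.eqb (h (N.land a b)) (N.land (h a) (h b)) &&
      N.eqb (h (N.lor a b)) (N.lor (h a) (h b)) &&
      N.eqb (h (imp F a b)) (imp G (h a) (h b))) D) D.

Lemma imp_refl F u : imp F u u = top F.
Proof.
  unfold top; induction F as [|a F IH]; simpl; trivial.
  rewrite IH, N.land_0_r; simpl.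
  replace (N.ldiff (N.land a u) u) with 0%N; trivial.
  apply N.bits_inj; intros i.
  rewrite N.ldiff_spec, N.land_spec, N.bits_0.
  now destruct (N.testbit a i), (N.testbit u i).
Qed.

Lemma mem_In u D : mem u D = true <-> In u D.
Proof.
  unfold mem; rewrite existsb_exists; split.
  - intros (x & Hx & E); apply N.eqb_eq in E; now subst.
  - intros H; exists u; split; trivial; apply N.eqb_refl.
Qed.

Lemma closed_spec F D :
  closed F D = true <->
  forall a, In a D -> In (imp F a 0) D /\
    forall b, In b D ->
      In (N.land a b) D /\ In (N.lor a b) D /\ In (imp F a b) D.
Proof.
  unfold closed; rewrite forallb_forall.
  setoid_rewrite andb_true_iff; setoid_rewrite forallb_forall.
  repeat setoid_rewrite andb_true_iff; repeat setoid_rewrite mem_In.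
  firstorder.
Qed.

Lemma morphism_spec F G h D :
  morphism F G h D = true <->
  forall a, In a D -> h (imp F a 0) = imp G (h a) 0 /\
    forall b, In b D ->
      h (N.land a b) = N.land (h a) (h b) /\
      h (N.lor a b) = N.lor (h a) (h b) /\
      h (imp F a b) = imp G (h a) (h b).
Proof.
  unfold morphism; rewrite forallb_forall.
  setoid_rewrite andb_true_iff; setoid_rewrite forallb_forall.
  repeat setoid_rewrite andb_true_iff; repeat setoid_rewrite N.eqb_eq.
  firstorder.
Qed.

Lemma morphism_comp F G H g h D Z :
  (forall a, In a D -> In (g a) Z) ->
  morphism F G g D = true -> morphism G H h Z = true ->
  morphism F H (fun a => h (g a)) D = true.
Proof.
  rewrite !morphism_spec; intros HZ Hg Hh a Ha.
  destruct (Hg a Ha) as [-> Hg'], (Hh (g a) (HZ a Ha)) as [-> Hh'].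
  split; trivial; intros b Hb.
  destruct (Hg' b Hb) as (-> & -> & ->); auto.
Qed.

Lemma morphism_top F G h D a :
  In a D -> morphism F G h D = true -> h (top F) = top G.
Proof.
  rewrite morphism_spec; intros Ha H.
  rewrite <- (imp_refl F a), <- (imp_refl G (h a)).
  now apply H.
Qed.

Lemma eval_closed F D v A :
  closed F D = true -> (forall i, In (v i) D) -> In (eval F v A) D.
Proof.
  rewrite closed_spec; intros HD Hv.
  induction A as [i|A IA B IB|A IA B IB|A IA B IB|A IA]; simpl; trivial;
    destruct (HD _ IA) as [Hn Hb]; trivial; now destruct (Hb _ IB) as (? & ? & ?).
Qed.

Lemma eval_morphism F G h D v A :
  closed F D = true -> morphism F G h D = true -> (forall i, In (v i) D) ->
  eval G (fun i => h (v i)) A = h (eval F v A).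
Proof.
  intros HD Hh Hv; pose proof (fun B => eval_closed F D v B HD Hv) as He.
  rewrite morphism_spec in Hh.
  induction A as [i|A IA B IB|A IA B IB|A IA B IB|A IA]; simpl; trivial;
    rewrite IA, ?IB; destruct (Hh _ (He A)) as [Hn Hb]; try easy;
    now destruct (Hb _ (He B)) as (? & ? & ?).
Qed.

Lemma eval_subst F v s A :
  eval F v (subst s A) = eval F (fun i => eval F v (s i)) A.
Proof. induction A; simpl; congruence. Qed.

Lemma eval_below F n v v' A :
  (forall i, i < n -> v i = v' i) -> below n A = true ->
  eval F v A = eval F v' A.
Proof.
  intros Hv; induction A; simpl; rewrite ?andb_true_iff, ?Nat.ltb_lt;
    [auto | intros; f_equal; tauto..].
Qed.

Lemma eval_ext F v v' A :
  (forall i, v i = v' i) -> eval F v A = eval F v' A.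
Proof. intros Hv; induction A; simpl; congruence. Qed.

(** * The system of all rules valid in given algebras *)

Definition valid (K : list frame) (Gamma : list formula) (A : formula) : Prop :=
  forall F v, In F K -> (forall i, In (v i) (elements F)) ->
    (forall B, In B Gamma -> eval F v B = top F) -> eval F v A = top F.

Definition truth : formula := Imp (Var 0) (Var 0).

Lemma eval_truth F v : eval F v truth = top F.
Proof. apply imp_refl. Qed.

Lemma valid_axiom_exists K : exists A, valid K [] A.
Proof. exists truth; intros F v _ _ _; apply eval_truth. Qed.

Lemma valid_rule_exists K : exists r, valid K (premises r) (conclusion r).
Proof.
  exists (Rule [] truth); intros F v _ _ _; apply eval_truth.
Qed.

Definition system (K : list frame) : deductive_system :=
  {| axioms := valid K [];
     rules := fun r => valid K (premises r) (conclusion r);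
     axioms_nonempty := valid_axiom_exists K;
     rules_nonempty := valid_rule_exists K |}.

Lemma valid_derives K S Gamma A :
  (forall F, In F K -> closed F (elements F) = true) ->
  (forall B, axioms S B -> valid K [] B) ->
  (forall r, rules S r -> valid K (premises r) (conclusion r)) ->
  derives S Gamma A -> valid K Gamma A.
Proof.
  intros HK Ha Hr HA F v HF Hv HG; revert A HA; apply derives_ind; trivial.
  - intros s A HA; rewrite eval_subst; apply (Ha _ HA); trivial; [|easy].
    intros i; apply eval_closed; auto.
  - intros s r HR H; rewrite eval_subst; apply (Hr _ HR); trivial.
    + intros i; apply eval_closed; auto.
    + intros B HB; rewrite <- eval_subst; auto.
Qed.

Lemma subst_Var A : subst Var A = A.
Proof. induction A; simpl; congruence. Qed.

(** A valid rule belongs to the system, so one step with the identity substitution derives it; the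
    converse is soundness. *)
Lemma derives_system K Gamma A :
  (forall F, In F K -> closed F (elements F) = true) ->
  derives (system K) Gamma A <-> valid K Gamma A.
Proof.
  intros HK; split.
  - apply valid_derives; trivial.
  - intros H; rewrite <- (subst_Var A).
    apply (derives_rule (system K) Gamma Var (Rule Gamma A)); [exact H|].
    intros B HB; rewrite subst_Var; now apply derives_hyp.
Qed.

(** * A criterion for hereditary structural completeness *)

(** The default makes variables beyond the list behave as if [truth] were substituted for them. *)
Definition val (F : frame) (l : list N) (i : nat) : N := nth i l (top F).

Fixpoint tuples {X : Type} (n : nat) (D : list X) : list (list X) :=
  match n with
  | 0 => [[]]
  | S n => flat_map (fun l => map (fun d => d :: l) D) (tuples n D)
  end.

Fixpoint sublists {X : Type} (l : list X) : list (list X) :=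
  match l with
  | [] => [[]]
  | x :: l => flat_map (fun D => [D; x :: D]) (sublists l)
  end.

Lemma tuples_spec {X : Type} n (D l : list X) :
  In l (tuples n D) <-> length l = n /\ incl l D.
Proof.
  revert l; induction n as [|n IH]; intros l; simpl.
  - split.
    + intros [<- | []]; split; trivial; apply incl_nil_l.
    + intros [H _]; left; symmetry; now apply length_zero_iff_nil.
  - rewrite in_flat_map; split.
    + intros (l' & Hl' & Hl); apply in_map_iff in Hl as (d & <- & Hd).
      apply IH in Hl' as [<- Hi]; split; trivial; now apply incl_cons.
    + intros [Hl Hi]; destruct l as [|d l]; [easy|].
      apply incl_cons_inv in Hi as [Hd Hi].
      exists l; split; [apply IH; split; trivial; now injection Hl|].
      now apply (in_map (fun d => d :: l)).
Qed.

(** Classical logic brings the set of values of a valuation, known only through a predicate, within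
    the finite range of [separated]. *)
Lemma sublists_comprehension {X : Type} (P : X -> Prop) (l : list X) :
  exists D, In D (sublists l) /\ forall x, In x D <-> In x l /\ P x.
Proof.
  induction l as [|y l (D & HD & H)]; simpl.
  - exists []; split; [now left | simpl; tauto].
  - destruct (classic (P y)) as [Hy | Hy];
      [exists (y :: D) | exists D]; split;
      try (apply in_flat_map; exists D; simpl; tauto);
      intros x; simpl; rewrite H; split; intuition (subst; tauto).
Qed.

Lemma finite_collection {X Y : Type} (P : X -> Prop) (Q : Y -> Prop)
    (R : X -> Y -> Prop) (l : list X) :
  (forall x, In x l -> P x \/ exists y, Q y /\ R x y) ->
  exists L, (forall y, In y L -> Q y) /\
    forall x, In x l -> P x \/ exists y, In y L /\ R x y.
Proof.
  induction l as [|x l IH]; intros H; [now exists []|].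
  destruct IH as (L & HL & Hl); [intros; apply H; now right|].
  destruct (H x) as [Hx | (y & Hy & Hxy)]; [now left| |].
  - exists L; split; trivial; intros x' [<- | Hx']; auto.
  - exists (y :: L); split.
    + intros y' [<- | Hy']; auto.
    + intros x' [<- | Hx']; [right; exists y; simpl; auto|].
      destruct (Hl x' Hx') as [H' | (y' & Hy' & H')]; [now left|].
      right; exists y'; simpl; auto.
Qed.

Lemma val_map F (D : list N) v n i :
  i < n -> val F (map v (seq 0 n)) i = v i.
Proof.
  intros Hi; unfold val.
  rewrite nth_indep with (d' := v 0) by now rewrite length_map, length_seq.
  now rewrite map_nth, seq_nth.
Qed.

Lemma map_seq_tuples {X : Type} (D : list X) v n :
  (forall i, In (v i) D) -> In (map v (seq 0 n)) (tuples n D).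
Proof.
  intros Hv; apply tuples_spec; split; [now rewrite length_map, length_seq|].
  intros x Hx; apply in_map_iff in Hx as (i & <- & _); trivial.
Qed.

Lemma val_In F D l i : In (top F) D -> incl l D -> In (val F l i) D.
Proof.
  intros Ht Hl; unfold val.
  destruct (nth_in_or_default i l (top F)) as [H | ->]; auto.
Qed.

(* The preimage of d under the map of points whose list of values is f. *)
Fixpoint pull (F : frame) (f : list N) (d : N) : N :=
  match F, f with
  | _ :: F', x :: f' =>
      (if N.testbit d x then N.succ_double else N.double) (pull F' f' d)
  | _, _ => 0%N
  end.

(* A homomorphism from subalgebras of an algebra onto an algebra Z, described by
   the map [points] of frames, together with an embedding of Z into the free
   algebra on [arity] generators, sending z to the class of [term z]. *)
Record retraction := Retraction {
  arity : nat;
  points : list N;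
  term : N -> formula
}.

(** The free algebra embeds in a power of the algebra of [F], so it is enough to test the terms
    under each valuation of the generators. *)
Definition projective (F : frame) (e : retraction) : bool :=
  let Z := nodup N.eq_dec (map (pull F (points e)) (elements F)) in
  closed F Z && forallb (fun z => below (arity e) (term e z)) Z &&
  forallb (fun w => morphism F F (fun z => eval F (val F w) (term e z)) Z)
    (tuples (arity e) (elements F)).

(** The entries of [g] stay in [D] because they must be values of formulas, which then replace the
    generators. *)
Definition separates (F : frame) (D : list N) (b : N) (e : retraction) : bool :=
  if morphism F F (pull F (points e)) D then
    existsb (fun g =>
      negb (N.eqb (eval F (val F g) (term e (pull F (points e) b))) (top F)))
      (tuples (arity e) D)
  else false.

Definition separated (F : frame) (es : list retraction) : bool :=
  forallb (fun D =>
    if closed F D then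
      forallb (fun b => if N.eqb b (top F) then true
                        else existsb (separates F D b) es) D
    else true) (sublists (elements F)).

(** The terms use only variables below [arity e], so the tested tuples account for every
    valuation. *)
Lemma projective_morphism F e v :
  projective F e = true -> (forall i, In (v i) (elements F)) ->
  morphism F F (fun z => eval F v (term e z))
    (nodup N.eq_dec (map (pull F (points e)) (elements F))) = true.
Proof.
  unfold projective; set (Z := nodup _ _).
  rewrite !andb_true_iff, !forallb_forall; intros [[Hc Hb] Hm] Hv.
  assert (E : forall z, In z Z ->
    eval F (val F (map v (seq 0 (arity e)))) (term e z) = eval F v (term e z)).
  { intros z Hz; apply eval_below with (arity e); [|now apply Hb].
    intros i Hi; now apply val_map. }
  specialize (Hm _ (map_seq_tuples _ _ (arity e) Hv)).
  rewrite closed_spec in Hc; rewrite morphism_spec in *.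
  intros a Ha; destruct (Hm a Ha) as [Hn Hm'], (Hc a Ha) as [Hcn Hc'].
  rewrite !E in Hn by trivial; split; trivial; intros b Hb'.
  specialize (Hm' b Hb'); destruct (Hc' b Hb') as (? & ? & ?).
  now rewrite !E in Hm' by trivial.
Qed.

(* Let Gamma/A be a rule that an extension S of [system [F]] does not derive.
   As the algebra of F is finite, some valuation into it satisfies every
   consequence of Gamma in S but not A. *)
Lemma separating_valuation F S Gamma A :
  closed F (elements F) = true -> In (top F) (elements F) ->
  deductive_extension (system [F]) S ->
  ~ derives S Gamma A ->
  exists v, (forall i, In (v i) (elements F)) /\ eval F v A <> top F /\
    forall B, derives S Gamma B -> eval F v B = top F.
Proof.
  intros HF Ht HS HA.
  destruct (below_exists (A :: Gamma)) as [n Hn].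
  (* [s] fixes [A] and [Gamma] and gives all other variables the value top, so only tuples of length
     [n] matter. *)
  set (s := fun i => if Nat.ltb i n then Var i else truth).
  assert (Hs : forall B, In B (A :: Gamma) -> subst s B = B).
  { intros B HB; apply subst_below with n; auto.
    intros i Hi; unfold s; apply Nat.ltb_lt in Hi; now rewrite Hi. }
  assert (Hval : forall v B,
    eval F v (subst s B) = eval F (val F (map v (seq 0 n))) B).
  { intros v B; rewrite eval_subst; apply eval_ext; intros i; unfold s.
    destruct (Nat.ltb_spec i n) as [Hi | Hi].
    - symmetry; now apply val_map.
    - unfold val; rewrite nth_overflow; [apply eval_truth|].
      now rewrite length_map, length_seq. }
  apply NNPP; intros HN.
  (* Without such a valuation, each tuple refuting [A] refutes some consequence of [Gamma]; one is
     chosen per tuple. *)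
  destruct (finite_collection (fun l => eval F (val F l) A = top F)
    (derives S Gamma) (fun l B => eval F (val F l) B <> top F)
    (tuples n (elements F))) as (L & HL & HR).
  { intros l Hl; apply tuples_spec in Hl as [_ Hl].
    apply NNPP; intros H; apply HN; exists (val F l); split; [|split].
    - intros i; now apply val_In.
    - tauto.
    - intros B HB; apply NNPP; intros HB'; apply H; right; now exists B. }
  (* Under [s] the chosen consequences validly entail [A], and they still follow from [Gamma], which
     [s] fixes. *)
  apply HA, derives_cut with (map (subst s) L).
  - intros B HB; apply in_map_iff in HB as (C & <- & HC).
    replace Gamma with (map (subst s) Gamma); [now apply derives_subst, HL|].
    rewrite <- map_id; apply map_ext_in; intros B HB; apply Hs; now right.
  - apply HS, derives_system; [now intros G [<- | []]|].
    intros G v [<- | []] Hv H.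
    rewrite <- (Hs A), Hval by now left.
    destruct (HR (map v (seq 0 n))) as [HR' | (B & HB & HR')]; trivial.
    + now apply map_seq_tuples.
    + destruct HR'; rewrite <- Hval; now apply H, in_map.
Qed.

Lemma structurally_complete_extension F es S :
  closed F (elements F) = true -> In (top F) (elements F) ->
  forallb (projective F) es = true -> separated F es = true ->
  deductive_extension (system [F]) S -> structurally_complete S.
Proof.
  intros HF Ht Hes Hsep HS [Gamma A] Hadm; unfold derivable; simpl.
  apply NNPP; intros HN.
  destruct (separating_valuation F S Gamma A) as (v & Hv & HvA & HvG); trivial.
  destruct (sublists_comprehension (fun d => exists B, eval F v B = d)
    (elements F)) as (D & HD & HDs).
  assert (HeD : forall B, In (eval F v B) D).
  { intros B; apply HDs; split; [now apply eval_closed | now exists B]. }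
  assert (HvD : forall i, In (v i) D) by (intros i; apply (HeD (Var i))).
  assert (HcD : closed F D = true).
  { apply closed_spec; intros a Ha; apply HDs in Ha as [_ [B <-]].
    split; [exact (HeD (Neg B))|].
    intros b Hb; apply HDs in Hb as [_ [C <-]].
    split; [exact (HeD (And B C)) | split];
      [exact (HeD (Or B C)) | exact (HeD (Imp B C))]. }
  unfold separated in Hsep; rewrite forallb_forall in Hsep.
  specialize (Hsep D HD); rewrite HcD, forallb_forall in Hsep.
  specialize (Hsep _ (HeD A)).
  apply N.eqb_neq in HvA; rewrite HvA in Hsep.
  apply existsb_exists in Hsep as (e & He & Hsep).
  unfold separates in Hsep.
  destruct (morphism F F (pull F (points e)) D) eqn:Hpull; [|easy].
  apply existsb_exists in Hsep as (g & Hg & Hgt).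
  apply negb_true_iff, N.eqb_neq in Hgt; apply tuples_spec in Hg as [Hlen Hg].
  rewrite forallb_forall in Hes; specialize (Hes e He).
  (* Each variable goes to the term of the image of its value; by homomorphy the same then holds
     semantically for every formula. *)
  set (t := fun i => term e (pull F (points e) (v i))).
  assert (Hh : forall w, (forall i, In (w i) (elements F)) ->
    morphism F F (fun d => eval F w (term e (pull F (points e) d))) D = true).
  { intros w Hw.
    apply (morphism_comp F F F (pull F (points e))
      (fun z => eval F w (term e z)) D
      (nodup N.eq_dec (map (pull F (points e)) (elements F)))); trivial.
    - intros a Ha; apply nodup_In, in_map; now apply HDs.
    - now apply projective_morphism. }
  assert (Ht' : forall w, (forall i, In (w i) (elements F)) -> forall B,
    eval F w (subst t B) = eval F w (term e (pull F (points e) (eval F v B)))).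
  { intros w Hw B; rewrite eval_subst.
    exact (eval_morphism F F _ D v B HcD (Hh w Hw) HvD). }
  assert (HtA : theorems S (subst t A)).
  { apply (admissible_instance S (Rule Gamma A) t Hadm); simpl; intros B HB.
    apply HS, derives_system; [now intros G [<- | []]|].
    intros G w [<- | []] Hw _; rewrite Ht' by trivial.
    rewrite HvG by now apply derives_hyp.
    exact (morphism_top F F _ D (v 0) (HvD 0) (Hh w Hw)). }
  assert (Hl : exists l, map (eval F v) l = g).
  { clear - Hg HDs; induction g as [|d g IH]; [now exists []|].
    apply incl_cons_inv in Hg as [Hd Hg].
    destruct (IH Hg) as [l <-].
    apply HDs in Hd as [_ [B <-]]; now exists (B :: l). }
  destruct Hl as [l Hl].
  (* Formulas with values [g] replace the generators; the resulting theorem must be top at [v],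
     contrary to the choice of [g]. *)
  set (s := fun i => nth i l truth).
  assert (Hs : forall i, eval F v (s i) = val F g i).
  { intros i; unfold s, val; rewrite <- Hl, <- (eval_truth F v).
    symmetry; apply map_nth. }
  apply Hgt; rewrite <- Ht'.
  - rewrite <- (eval_ext F _ _ _ Hs), <- eval_subst; apply HvG.
    apply (derives_cut S Gamma []); [easy|].
    exact (derives_subst S [] _ s HtA).
  - intros i; apply val_In; trivial.
    intros d Hd; now apply HDs, Hg.
Qed.

Lemma hereditarily_structurally_complete_system F es :
  closed F (elements F) = true -> In (top F) (elements F) ->
  forallb (projective F) es = true -> separated F es = true ->
  hereditarily_structurally_complete (system [F]).
Proof.
  intros HF Ht Hes Hsep.
  assert (H : forall S, deductive_extension (system [F]) S ->
                        structurally_complete S)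
    by (intros S; now apply structurally_complete_extension with es).
  split; [apply H; now intros Gamma A | exact H].
Qed.

Definition intuitionistic (F : frame) : bool :=
  forallb (fun w => forallb (fun A => N.eqb (eval F (val F w) A) (top F))
    ipc_axioms) (tuples 3 (elements F)) &&
  forallb (fun u => N.eqb (imp F (top F) u) u) (elements F).

Lemma IPC_extension F :
  closed F (elements F) = true -> intuitionistic F = true ->
  deductive_extension IPC (system [F]).
Proof.
  unfold intuitionistic; rewrite andb_true_iff, !forallb_forall.
  intros HF [Ha Hm] Gamma A HA.
  assert (HF' : forall G, In G [F] -> closed G (elements G) = true)
    by now intros G [<- | []].
  apply derives_system; trivial.
  revert HA; apply valid_derives; trivial.
  - intros B HB G v [<- | []] Hv _.
    specialize (Ha _ (map_seq_tuples _ _ 3 Hv)); rewrite forallb_forall in Ha.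
    specialize (Ha B HB); apply N.eqb_eq in Ha; rewrite <- Ha.
    apply eval_below with 3; [intros i Hi; symmetry; now apply val_map|].
    assert (H : forallb (below 3) ipc_axioms = true) by reflexivity.
    rewrite forallb_forall in H; auto.
  - intros r -> G v [<- | []] Hv H.
    specialize (Hm _ (Hv 1)); apply N.eqb_eq in Hm; simpl; rewrite <- Hm.
    rewrite <- (H (Var 0)) at 1 by now left.
    apply (H (Imp (Var 0) (Var 1))); right; now left.
Qed.

(** * The two algebras *)

Open Scope N_scope.

Definition frame_E : frame := [1; 2; 5; 11; 31].
Definition frame_A : frame := [1; 2; 5; 11; 31; 39].

Definition p := Var 0.
Definition q := Var 1.
Definition bot := Neg truth.

(* The formula with value z in [frame_A] when p has the value {0}. *)
Definition nishimura (z : N) : formula :=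
  let r3 := Imp (Neg (Neg p)) p in
  let r5 := Imp r3 (Or p (Neg p)) in
  match z with
  | 0 => bot
  | 1 => p
  | 2 => Neg p
  | 3 => Or p (Neg p)
  | 5 => Neg (Neg p)
  | 7 => Or (Neg p) (Neg (Neg p))
  | 11 => r3
  | 15 => Or (Neg (Neg p)) r3
  | 31 => Imp r5 (Or (Neg p) (Neg (Neg p)))
  | 39 => r5
  | 47 => Or r3 r5
  | _ => truth
  end.

(* [Or q (Imp q e)] is a generic element x above e with [Imp x e] = e, and
   [Imp q e], [Imp (Imp q e) e] is a generic pair of elements that meet in e and
   are pseudocomplements of each other relative to e. *)
Definition chain4 (z : N) : formula :=
  let e := Or p (Neg p) in
  if N.testbit z 4 then truth
  else if N.testbit z 2 then Or q (Imp q e)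
  else if N.testbit z 0 then e else bot.

Definition fork (z : N) : formula :=
  let e := Or (Neg p) (Neg (Neg p)) in
  if N.testbit z 4 then truth
  else if N.testbit z 3 then Or q (Imp q e)
  else match z with 0 => bot | 2 => Neg p | 5 => Neg (Neg p) | _ => e end.

Definition diamond (z : N) : formula :=
  let e := Or p (Neg p) in
  let c := Imp q e in
  let c' := Imp c e in
  if N.testbit z 4 then truth
  else if N.testbit z 2
  then if N.testbit z 3 then Or c c' else c
  else if N.testbit z 3 then c'
  else if N.testbit z 0 then e else bot.

(** The image frames are, in order, the ladder itself, a chain of two points, two chains of three, a
    fork with a point below its root, and a diamond. The two longer chains serve different
    subalgebras. The sixth entries concern [frame_A] only. *)
Definition retractions_E :=
  [ Retraction 1 [0; 1; 2; 3; 4; 5] nishimura;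
    Retraction 1 [0; 0; 4; 4; 4; 4] chain4;
    Retraction 2 [0; 0; 2; 2; 4; 4] chain4;
    Retraction 2 [0; 0; 3; 3; 4; 4] chain4;
    Retraction 2 [0; 1; 0; 3; 4; 3] fork;
    Retraction 2 [0; 0; 2; 3; 4; 2] diamond ].

Definition retractions_A := retractions_E ++
  [ Retraction 1 [0; 0; 5; 5; 5; 5] chain4;
    Retraction 1 [0; 1; 0; 5; 5; 5] fork;
    Retraction 2 [0; 0; 2; 2; 5; 5] chain4 ].


Close Scope N_scope.

(** * Hereditary structural completeness of the two systems *)

Lemma closed_A : closed frame_A (elements frame_A) = true.
Proof. vm_compute; reflexivity. Qed.

Lemma closed_E : closed frame_E (elements frame_E) = true.
Proof. vm_compute; reflexivity. Qed.

Lemma extension_A : deductive_extension IPC (system [frame_A]).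
Proof. apply IPC_extension; [exact closed_A | vm_compute; reflexivity]. Qed.

Lemma extension_E : deductive_extension IPC (system [frame_E]).
Proof. apply IPC_extension; [exact closed_E | vm_compute; reflexivity]. Qed.

Lemma hereditary_A : hereditarily_structurally_complete (system [frame_A]).
Proof.
  apply hereditarily_structurally_complete_system with retractions_A;
    [exact closed_A | apply mem_In | |]; vm_compute; reflexivity.
Qed.

Lemma hereditary_E : hereditarily_structurally_complete (system [frame_E]).
Proof.
  apply hereditarily_structurally_complete_system with retractions_E;
    [exact closed_E | apply mem_In | |]; vm_compute; reflexivity.
Qed.

(** The points of [frame_E] form an upset of [frame_A], so intersecting with them is a homomorphism,
    and it fixes every upset of [frame_E]. *)
Lemma valid_A_E A : valid [frame_A] [] A -> valid [frame_E] [] A.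
Proof.
  intros HA F v [<- | []] Hv _.
  assert (Hr : forall u, In u (elements frame_E) ->
    In u (elements frame_A) /\ N.land (top frame_E) u = u).
  { assert (H : forallb (fun u => mem u (elements frame_A) &&
      N.eqb (N.land (top frame_E) u) u) (elements frame_E) = true)
      by (vm_compute; reflexivity).
    rewrite forallb_forall in H; intros u Hu; specialize (H u Hu).
    apply andb_true_iff in H as [H1 H2].
    split; [now apply mem_In | now apply N.eqb_eq]. }
  assert (HvA : forall i, In (v i) (elements frame_A)) by (intros; now apply Hr).
  rewrite (eval_ext _ _ (fun i => N.land (top frame_E) (v i)))
    by (intros i; symmetry; now apply Hr).
  rewrite (eval_morphism frame_A frame_E (N.land (top frame_E))
    (elements frame_A) v A closed_A); [|vm_compute; reflexivity | exact HvA].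
  now rewrite (HA frame_A v (or_introl eq_refl) HvA).
Qed.

(* At the generator, [nishimura 31] holds exactly at the points of [frame_E] and
   [nishimura 15] exactly at the points other than 4 and 5. *)
Definition nonembedding_rule : rule :=
  Rule [nishimura 31] (nishimura 15).

Lemma nonembedding_rule_A : valid [frame_A] [nishimura 31] (nishimura 15).
Proof.
  intros F v [<- | []] Hv H; specialize (H _ (or_introl eq_refl)).
  assert (HA : forallb (fun u =>
    negb (N.eqb (eval frame_A (fun _ => u) (nishimura 31)) (top frame_A)) ||
    N.eqb (eval frame_A (fun _ => u) (nishimura 15)) (top frame_A))
    (elements frame_A) = true) by (vm_compute; reflexivity).
  rewrite forallb_forall in HA; specialize (HA _ (Hv 0)).
  change (eval frame_A (fun _ => v 0) (nishimura 31))
    with (eval frame_A v (nishimura 31)) in HA.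
  rewrite H, N.eqb_refl in HA; now apply N.eqb_eq.
Qed.

Lemma nonembedding_rule_E : ~ valid [frame_E] [nishimura 31] (nishimura 15).
Proof.
  (* The number 1 encodes the upset {0}, the generator. *)
  intros H; specialize (H frame_E (fun _ => 1%N) (or_introl eq_refl)).
  discriminate H.
  - intros _; apply mem_In; vm_compute; reflexivity.
  - intros B [<- | []]; vm_compute; reflexivity.
Qed.

(** * The joint system of both algebras *)

Lemma closed_AE F :
  In F [frame_A; frame_E] -> closed F (elements F) = true.
Proof. intros [<- | [<- | []]]; [exact closed_A | exact closed_E]. Qed.

Lemma not_complete_AE : ~ structurally_complete (system [frame_A; frame_E]).
Proof.
  intros H; apply nonembedding_rule_E.
  assert (HE : derivable (system [frame_A; frame_E]) nonembedding_rule).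
  { apply H; intros A; split; intros HA.
    - apply derives_system; [exact closed_AE|].
      (* Adding the rule preserves soundness for [frame_A] only; [valid_A_E] then carries theorems
         over to [frame_E]. *)
      assert (HA' : valid [frame_A] [] A).
      { revert HA; apply valid_derives.
        - intros F [<- | []]; exact closed_A.
        - intros B HB F v [<- | []]; apply HB; now left.
        - intros r [Hr | ->]; [|exact nonembedding_rule_A].
          intros F v [<- | []]; apply Hr; now left. }
      intros F v [<- | [<- | []]]; [apply HA' | apply (valid_A_E A HA')];
        now left.
    - revert HA; apply derives_ind; [easy| |].
      + intros s B; apply (derives_axiom (add_rule _ _)).
      + intros s r Hr; apply (derives_rule (add_rule _ _)); now left. }
  apply derives_system in HE; [|exact closed_AE].
  intros F v [<- | []]; apply HE; right; now left.
Qed.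

Theorem theorem5p15 :
  ~ exists S0 : deductive_system,
      deductive_extension IPC S0
      /\ hereditarily_structurally_complete S0
      /\ forall S : deductive_system,
           deductive_extension IPC S ->
           hereditarily_structurally_complete S ->
           deductive_extension S0 S.
Proof.
  intros (S0 & _ & [_ Hher] & Hleast); apply not_complete_AE, Hher.
  intros Gamma A HA; apply derives_system; [exact closed_AE|].
  assert (HvA : valid [frame_A] Gamma A).
  { apply derives_system; [intros F [<- | []]; exact closed_A|].
    apply (Hleast _ extension_A hereditary_A Gamma A HA). }
  assert (HvE : valid [frame_E] Gamma A).
  { apply derives_system; [intros F [<- | []]; exact closed_E|].
    apply (Hleast _ extension_E hereditary_E Gamma A HA). }
  intros F v [<- | [<- | []]]; [apply HvA | apply HvE]; now left.
Qed.
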